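(* If $L$ is a Lawson compact algebraic $L$-domain, then $CO(L)$, the set of compact-open subsets of $L$ in the Scott topology ordered by inclusion, is an $FDD$-lattice.
   Context: For a poset $P$ and $x\in P$: ${\uparrow}x=\{y\in P: y\ge x\}$, ${\downarrow}x=\{y\in P: y\le x\}$. A subset $D$ of $P$ is directed if every finite subset of $D$ (including the empty one) has an upper bound in $D$; $\bigvee^{\uparrow} D$ denotes the supremum of a directed set $D$. A dcpo is a poset in which every directed subset has a supremum. A subset $U\subseteq P$ is Scott open if it is an upper set and, for each directed $D$ whose supremum exists, $\bigvee^{\uparrow}D\in U$ implies $D\cap U\neq\emptyset$; the Scott open sets form the Scott topology $\sigma(P)$. An element $x\in P$ is compact if for every directed $D\subseteq P$ with existing supremum and $x\le\bigvee^{\uparrow}D$ there is $d\in D$ with $x\le d$; $K(P)$ is the set of compact elements. An algebraic domain is a dcpo $L$ such that for every $x\in L$ the set ${\downarrow}x\cap K(L)$ is directed and $x=\bigvee^{\uparrow}({\downarrow}x\cap K(L))$. An algebraic $L$-domain is an algebraic domain in which every principal ideal ${\downarrow}x$ is a complete lattice in its induced order. The lower topology $\omega(L)$ is generated by the sets $L\setminus{\uparrow}x$, $x\in L$, as subbasic open sets; the Lawson topology is the common refinement $\sigma(L)\vee\omega(L)$. $L$ is Lawson compact if it is compact in the Lawson topology. For a bounded lattice $A$, $Cp(A)$ is the set of nonzero co-prime elements, i.e. of $p\neq 0$ such that $p\le x\vee y$ implies $p\le x$ or $p\le y$. Elements $x,y\in A$ are disjoint if $x\wedge y=0$; a finite subset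 $F\subseteq A$ is disjoint if any two different elements of $F$ are disjoint. A finitely disjunctive distributive lattice ($FDD$-lattice) is a bounded distributive lattice $A$ such that: (1) for each $x\in A$ there is a finite subset $F\subseteq Cp(A)$ with $x=\bigvee F$ (the empty join being $0$); (2) for any $a,b\in Cp(A)$, $a\wedge b$ is the join of a finite disjoint subset (possibly empty) of $Cp(A)$. *)

(* Defs.v *)
From HB Require Import structures.
From mathcomp Require Import all_boot all_order finmap.
From mathcomp Require Import boolp classical_sets functions cardinality topology.

Set Implicit Arguments.
Unset Strict Implicit.
Unset Printing Implicit Defensive.

Import Order.TTheory.

Local Open Scope classical_set_scope.
Local Open Scope order_scope.

(* A subset of a poset, as a poset in the induced order. *)
HB.instance Definition _ (d : Order.disp_t) (P : porderType d) (A : set P) :=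
  [SubChoice_isSubPOrder of {x : P | x \in A} by <: with d].

Section Domains.
Context (d : Order.disp_t) (P : porderType d).
Implicit Types (x y : P) (D U S : set P).

Definition principal_filter x : set P := [set y | x <= y].

Definition principal_ideal x : set P := [set y | y <= x].

(* [F] may be empty, so a directed set is nonempty. *)
Definition directed D :=
  forall F : set P, finite_set F -> F `<=` D -> exists2 y, D y & ubound F y.

Definition upper_set U := forall x y, U x -> x <= y -> U y.

Definition dcpo := forall D, directed D -> supremums D !=set0.

Definition scott_open U :=
  upper_set U /\
  forall D s, directed D -> supremums D s -> U s -> D `&` U !=set0.

Definition compact_elements : set P :=
  [set x | forall D s, directed D -> supremums D s -> x <= s ->
     exists2 y, D y & x <= y].

Definition algebraic_domain :=
  dcpo /\
  forall x, directed (principal_ideal x `&` compact_elements) /\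
            supremums (principal_ideal x `&` compact_elements) x.

Definition complete_lattice :=
  forall S, supremums S !=set0 /\ infimums S !=set0.

End Domains.

Definition algebraic_L_domain (d : Order.disp_t) (L : porderType d) :=
  algebraic_domain L /\ forall x : L, complete_lattice {y : L | y \in principal_ideal x}.

(* Aliases of [L] carrying the Scott, lower and Lawson topologies. *)
Definition scott (d : Order.disp_t) (L : porderType d) : Type := L.
Definition lower (d : Order.disp_t) (L : porderType d) : Type := L.
Definition lawson (d : Order.disp_t) (L : porderType d) : Type := L.

Section Topologies.
Context (d : Order.disp_t) (L : porderType d).

Lemma scott_openT : scott_open [set: L].
Proof.
split=> // D s dirD _ _.
have [y Dy _] := dirD set0 (finite_set0 _) (@sub0set _ _).
by exists y.
Qed.

Lemma scott_openI : setI_closed (@scott_open d L).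
Proof.
move=> U V [upU opU] [upV opV]; split.
  by move=> x y [Ux Vx] xy; split; [exact: upU xy|exact: upV xy].
move=> D s dirD sD [Us Vs].
have [u [Du Uu]] := opU D s dirD sD Us.
have [v [Dv Vv]] := opV D s dirD sD Vs.
have [||y Dy uby] := dirD [set u; v]; first exact: finite_set2.
  by move=> z [->|->].
exists y; split=> //; split.
  by apply: upU Uu _; apply: uby; left.
by apply: upV Vv _; apply: uby; right.
Qed.

Lemma scott_open_bigU (I : Type) (f : I -> set L) :
  (forall i, scott_open (f i)) -> scott_open (\bigcup_i f i).
Proof.
move=> opf; split.
  by move=> x y [i _ fx] xy; exists i => //; exact: (opf i).1 fx xy.
move=> D s dirD sD [i _ fs].
have [y [Dy fy]] := (opf i).2 D s dirD sD fs.
by exists y; split=> //; exists i.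
Qed.

HB.instance Definition _ := Choice.copy (scott L) L.
HB.instance Definition _ :=
  isOpenTopological.Build (scott L) scott_openT scott_openI scott_open_bigU.

HB.instance Definition _ := Choice.copy (lower L) L.
HB.instance Definition _ :=
  isSubBaseTopological.Build (lower L)
    [set U : set L | exists x : L, U = ~` principal_filter x] id.

HB.instance Definition _ := Choice.copy (lawson L) L.
HB.instance Definition _ :=
  isSubBaseTopological.Build (lawson L)
    [set U : set L | open (U : set (scott L)) \/ open (U : set (lower L))] id.

End Topologies.

Definition lawson_compact (d : Order.disp_t) (L : porderType d) :=
  compact [set: lawson L].

(* Ordered by inclusion, as a subset of the lattice [set (scott L)]. *)
Definition CO (d : Order.disp_t) (L : porderType d) : set (set (scott L)) :=
  [set U | compact U /\ open U].
Arguments CO {d} L.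

Section FDD.
Context (d : Order.disp_t).

Definition Cp (A : tbLatticeType d) : set A :=
  [set p : A | p <> \bot /\ forall x y : A, p <= x `|` y -> p <= x \/ p <= y].

Definition disjoint_fset (A : tbLatticeType d) (F : {fset A}) :=
  forall x y : A, x \in F -> y \in F -> x <> y -> x `&` y = \bot.

Definition FDD_axioms (A : tbDistrLatticeType d) :=
  (forall x : A, exists2 F : {fset A}, [set` F] `<=` @Cp A &
     x = \join_(p <- F) p) /\
  (forall a b : A, Cp a -> Cp b ->
     exists F : {fset A}, [/\ [set` F] `<=` @Cp A, disjoint_fset F &
       a `&` b = \join_(p <- F) p]).

(* The lattice operations of [P] are not part of the structure [P]: it must
   be the poset underlying some bounded distributive lattice. *)
Definition FDD_lattice (P : porderType d) :=
  exists2 A : tbDistrLatticeType d, A = P :> porderType d & FDD_axioms A.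

End FDD.

(* Main.v *)
From HB Require Import structures.
From mathcomp Require Import all_boot all_order finmap.
From mathcomp Require Import boolp classical_sets cardinality topology.
Require Import Defs.

Set Implicit Arguments.
Unset Strict Implicit.
Unset Printing Implicit Defensive.

Import Order.TTheory.

Local Open Scope order_scope.
Local Open Scope classical_set_scope.

(** In an algebraic domain every point of a Scott open set [U] lies above a
compact element of [U], and the principal filter of a compact element is
compact-open.  So the compact-open sets are the finite unions of principal
filters of compact elements ([CO_upper_closure]).

Unions of compact-open sets are compact-open in any space; intersections need
Lawson compactness.  A principal filter is closed in the lower topology, so a
compact-open set, being a finite union of such filters, is Lawson closed.
Hence so is the intersection of two compact-open sets.  A closed subset of the
compact space [L] is Lawson compact, and a fortiori Scott compact
([CO_setI]).  The set [L] itself is compact for the same reason.  Thus [CO L]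
is a ring of sets, and in particular a bounded distributive lattice
([ring_of_sets_tbDistrLattice]).

A principal filter [↑k] in [CO L] is co-prime: [↑k] is contained in an upper
set as soon as [k] belongs to it, and if [k] belongs to a union it belongs to
one of the two members.  Conversely a co-prime set, being a finite union of
such filters, is one of them.  This gives the first axiom, and reduces the
second to sets of the form [↑a ∩ ↑b].  Write such a set as the union of the
filters of a finite antichain [t] ([upper_closure_antichain]).  If [z] lies
above two members [x], [y] of [t], let [m] be their infimum in the complete
lattice [↓z]: [a] and [b] are lower bounds of [x] and [y] in [↓z], so [m] is in
[↑a ∩ ↑b], hence above some member of [t]; that member is below both [x] and
[y], so it equals both.  Therefore different members of [t] have disjoint
filters ([minimal_upper_bounds_disjoint]). *)

(** * Finitely generated upper sets *)

Section UpperClosure.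
Context (d : Order.disp_t) (L : porderType d).
Implicit Types (s t : seq L) (a b x y : L).

Definition upper_closure s : set L := [set x | exists2 k, k \in s & k <= x].

(** By induction on the list of generators: a new generator is dropped when an
old one is below it, and otherwise replaces the old ones above it. *)
Lemma upper_closure_antichain s :
  exists t, [/\ {subset t <= s}, upper_closure t = upper_closure s &
    forall x y, x \in t -> y \in t -> x <= y -> x = y].
Proof.
elim: s => [|x s [t [ts tE anti]]]; first by exists [::].
have [[y yt yx]|Nyx] := pselect (exists2 y, y \in t & y <= x).
  exists t; split=> //.
    by move=> z /ts zs; rewrite in_cons zs orbT.
  rewrite predeqE => z; split.
    rewrite tE => -[k ks kz]; exists k => //.
    by rewrite in_cons ks orbT.
  move=> [k]; rewrite in_cons => /orP[/eqP ->|ks] kz.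
    by exists y => //; exact: le_trans kz.
  by rewrite tE; exists k.
exists (x :: [seq y <- t | ~~ (x <= y)]); split.
- move=> z; rewrite !in_cons mem_filter => /orP[->//|/andP[_ /ts ->]].
  by rewrite orbT.
- rewrite predeqE => z; split.
    move=> [k]; rewrite in_cons mem_filter => /orP[/eqP ->|/andP[_ /ts ks]] kz.
      by exists x; rewrite // mem_head.
    by exists k; rewrite // in_cons ks orbT.
  move=> [k]; rewrite in_cons => /orP[/eqP ->|ks] kz.
    by exists x; rewrite // mem_head.
  have [k' k't k'z] : upper_closure t z by rewrite tE; exists k.
  have [xk'|xk'] := boolP (x <= k').
    by exists x; [rewrite mem_head|exact: le_trans k'z].
  by exists k'; rewrite // in_cons mem_filter xk' k't orbT.
- move=> y z; rewrite !in_cons !mem_filter.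
  move=> /orP[/eqP ->|/andP[xy yt]] /orP[/eqP ->|/andP[xz zt]] //.
  + by rewrite (negbTE xz).
  + by move=> yx; case: Nyx; exists y.
  + exact: anti.
Qed.

(** Here [t] lists the minimal upper bounds of [a] and [b].  A common upper bound
[z] of two of them, [x] and [y], would give an upper bound of [a] and [b] below
both, namely the infimum of [x] and [y] computed in [↓z]. *)
Lemma minimal_upper_bounds_disjoint a b t :
  (forall x : L, complete_lattice {y : L | y \in principal_ideal x}) ->
  principal_filter a `&` principal_filter b = upper_closure t ->
  (forall x y, x \in t -> y \in t -> x <= y -> x = y) ->
  forall x y, x \in t -> y \in t -> x <> y ->
  principal_filter x `&` principal_filter y = set0.
Proof.
move=> cpl abE anti x y xt yt xy; rewrite -subset0 => z [xz yz].
have ubt k : k \in t -> a <= k /\ b <= k.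
  by move=> kt; have : upper_closure t k; [exists k|rewrite -abE].
pose I := {y : L | y \in principal_ideal z}.
have inI w : w <= z -> w \in principal_ideal z by move=> ?; rewrite inE.
pose x' : I := exist _ x (inI _ xz); pose y' : I := exist _ y (inI _ yz).
have [_ [m [lbm glbm]]] := cpl z [set x'; y'].
have mx : val m <= x by apply: (lbm x'); left.
have my : val m <= y by apply: (lbm y'); right.
have lem w : w <= x -> w <= y -> w <= val m.
  move=> wx wy; pose w' : I := exist _ w (inI _ (le_trans wx xz)).
  by apply: (glbm w') => _ [->|->].
have [[ax bx] [ay b_y]] := (ubt x xt, ubt y yt).
have [k kt km] : upper_closure t (val m).
  by rewrite -abE; split; exact: lem.
apply: xy; rewrite -(anti k x kt xt (le_trans km mx)).
exact: anti kt yt (le_trans km my).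
Qed.

End UpperClosure.

(** * Lattices of finitely generated upper sets *)

Section UpperSetRepresentation.
Context (d d' : Order.disp_t) (L : porderType d) (A : tbDistrLatticeType d').
Variable v : A -> set L.
Hypothesis v_inj : injective v.
Hypothesis v0 : v \bot = set0.
Hypothesis vU : {morph v : x y / (x `|` y)%O >-> x `|` y}.
Hypothesis vI : {morph v : x y / (x `&` y)%O >-> x `&` y}.
Hypothesis v_upper : forall x, upper_set (v x).
(** An element of the range of [v] generated by one point plays the role of a
co-prime, and finitely many of them make up every element. *)
Hypothesis v_gen : forall x, exists2 s : seq L,
  (forall k, k \in s -> range v (principal_filter k)) & v x = upper_closure s.
Hypothesis v_disj : forall (a b : L) t,
  principal_filter a `&` principal_filter b = upper_closure t ->
  (forall x y, x \in t -> y \in t -> x <= y -> x = y) ->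
  forall x y, x \in t -> y \in t -> x <> y ->
  principal_filter x `&` principal_filter y = set0.
Implicit Types (x y p : A) (k : L) (s : seq L).

Let v_le x y : (x <= y)%O -> v x `<=` v y.
Proof. by move=> /meet_idPl xy; rewrite -xy vI => z []. Qed.

(* The element of [A] represented by the principal filter of [k]; the default
   value [\bot] is taken when [v] does not reach that filter. *)
Let up k : A := xget \bot [set x | v x = principal_filter k].

Let v_up k : range v (principal_filter k) -> v (up k) = principal_filter k.
Proof. by move=> [x _ xk]; rewrite /up; case: xgetP => // /(_ x). Qed.

Let up_le k x : range v (principal_filter k) -> (up k <= x)%O <-> v x k.
Proof.
move=> /v_up kE; split=> [/v_le|xk].
  by rewrite kE; apply; exact: lexx.
apply/meet_idPl/v_inj; rewrite vI kE; apply/setIidPl => y.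
exact: v_upper xk.
Qed.

Let up_Cp k : range v (principal_filter k) -> Cp (up k).
Proof.
move=> kr; split=> [k0|x y].
  have : (up k <= \bot)%O by rewrite k0 lexx.
  by move=> /(up_le _ kr); rewrite v0.
move=> /(up_le _ kr); rewrite vU.
by case=> /(up_le _ kr); [left|right].
Qed.

Let join_up s x : (forall k, k \in s -> range v (principal_filter k)) ->
  v x = upper_closure s -> x = (\join_(p <- [fset up k | k in s]%fset) p)%O.
Proof.
move=> sr xE; apply/eqP; rewrite eq_le; apply/andP; split; last first.
  apply/joinsP_seq => p /imfsetP[k /= ks ->] _.
  by apply/up_le; [exact: sr|rewrite xE; exists k].
apply/meet_idPl/v_inj; rewrite vI; apply/setIidPl => y.
rewrite xE => -[k ks ky]; apply: (v_upper _ ky).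
apply/up_le; first exact: sr.
by apply: (@joins_sup_seq _ _ _ _ xpredT id) => //; apply/imfsetP; exists k.
Qed.

(** A co-prime is below a finite join only if it is below one of the joinands;
the joinands given by [v_gen] are in turn below it. *)
Let Cp_up p : Cp p ->
  exists2 k, range v (principal_filter k) & p = up k.
Proof.
move=> [p0 pP]; have [s sr pE] := v_gen p.
have {pE}pE := join_up sr pE.
have le_p q : q \in [fset up k | k in s]%fset -> (q <= p)%O.
  by move=> qs; rewrite pE; exact: (@joins_sup_seq _ _ _ _ xpredT id).
have up_s q : q \in [fset up k | k in s]%fset ->
    exists2 k, range v (principal_filter k) & q = up k.
  by move=> /imfsetP[k /= /sr kr ->]; exists k.
have : (p <= \join_(q <- [fset up k | k in s]%fset) q)%O by rewrite -pE.
have sub : {subset enum_fset [fset up k | k in s]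
                  <= [fset up k | k in s]}%fset by [].
elim: (enum_fset _) sub => [|q r IH] rs.
  by rewrite big_nil lex0 => /eqP.
rewrite big_cons => /pP[pq|].
  have qs := rs q (mem_head q r).
  suff -> : p = q by exact: up_s.
  by apply: le_anti; rewrite pq le_p.
by apply: IH => z zr; apply: rs; rewrite in_cons zr orbT.
Qed.

(** For the second axiom, the generators of the intersection of two principal
filters are thinned to an antichain, so that [v_disj] applies. *)
Lemma FDD_axioms_upper_sets : FDD_axioms A.
Proof.
split=> [x|_ _ /Cp_up[a ar ->] /Cp_up[b br ->]].
  have [s sr xE] := v_gen x.
  exists [fset up k | k in s]%fset; last exact: join_up.
  by move=> _ /imfsetP[k /= /sr kr ->]; exact: up_Cp.
have [s sr abE] := v_gen (up a `&` up b)%O.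
have [t [ts tE anti]] := upper_closure_antichain s.
have tr k : k \in t -> range v (principal_filter k) by move=> /ts; exact: sr.
rewrite -tE in abE.
exists [fset up k | k in t]%fset; split; last exact: join_up.
- by move=> _ /imfsetP[k /= /tr kr ->]; exact: up_Cp.
- move=> _ _ /imfsetP[x /= xt ->] /imfsetP[y /= yt ->] xy.
  apply: v_inj; rewrite vI v0 !v_up; [|exact: tr|exact: tr].
  rewrite vI !v_up// in abE.
  by apply: (v_disj abE) => // xyE; apply: xy; rewrite xyE.
Qed.

End UpperSetRepresentation.

(** * Rings of sets as bounded distributive lattices *)

Section RingOfSets.
Context (T : Type) (C : set (set T)).
Hypotheses (C0 : C set0) (CT : C setT) (CU : setU_closed C) (CI : setI_closed C).

Let P : porderType set_display := {U : set T | U \in C}.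

Let mk U (UC : C U) : P := exist _ U (mem_set UC).

Let valC (x : P) : C (val x) := set_mem (valP x).

Let meet (x y : P) : P := mk (CI (valC x) (valC y)).
Let join (x y : P) : P := mk (CU (valC x) (valC y)).

Let leE (x y : P) : (x <= y)%O = `[< val x `<=` val y >].
Proof. by rewrite -[(x <= y)%O]/(val x <= val y)%O -subsetEset asboolb. Qed.

Let meetP (x y z : P) : (x <= meet y z)%O = (x <= y)%O && (x <= z)%O.
Proof.
rewrite !leE; apply/asboolP/andP => [|[/asboolP xy /asboolP xz]].
  by rewrite subsetI => -[? ?]; split; exact/asboolP.
by rewrite subsetI.
Qed.

Let joinP (x y z : P) : (join x y <= z)%O = (x <= z)%O && (y <= z)%O.
Proof.
rewrite !leE; apply/asboolP/andP => [|[/asboolP xz /asboolP yz]].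
  by rewrite subUset => -[? ?]; split; exact/asboolP.
by rewrite subUset.
Qed.

Let le0P (x : P) : (mk C0 <= x)%O. Proof. by rewrite leE; exact/asboolP. Qed.
Let leP1 (x : P) : (x <= mk CT)%O. Proof. by rewrite leE; exact/asboolP. Qed.

Let meetUl : left_distributive meet join.
Proof. by move=> x y z; apply: val_inj; exact: setIUl. Qed.
Let joinIl : left_distributive join meet.
Proof. by move=> x y z; apply: val_inj; exact: setUIl. Qed.

Let lattice : latticeType set_display :=
  HB.pack (P : Type) P (Order.POrder_MeetJoin_isLattice.Build _ P meetP joinP).

Let A : tbDistrLatticeType set_display :=
  HB.pack (P : Type) lattice
   (Order.Lattice_isDistributive.Build _ lattice meetUl joinIl)
   (Order.hasBottom.Build _ P le0P) (Order.hasTop.Build _ P leP1).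

(** The lattice structure is packed on top of the given order, so that its
underlying poset is the ring ordered by inclusion definitionally.  It comes with
its embedding [v], as an abstract lattice in which no set is visible: the
equation between posets alone would leave the elements to be transported. *)
Lemma ring_of_sets_tbDistrLattice :
  exists2 A : tbDistrLatticeType set_display,
    A = {U : set T | U \in C} :> porderType set_display &
  exists v : A -> set T, [/\ injective v, range v = C, v \bot = set0,
    {morph v : x y / (x `|` y)%O >-> x `|` y} &
    {morph v : x y / (x `&` y)%O >-> x `&` y}].
Proof.
exists A => //; exists (fun x : P => val x); split=> //.
  exact: val_inj.
rewrite predeqE => U; split=> [[x _ <-]|UC]; first exact: valC.
by exists (mk UC).
Qed.

End RingOfSets.

(** * Compact-open sets of an algebraic domain *)

(** A nonempty space can be pointed at any of its points, and a finite cover of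
the empty set is the empty one. *)
Lemma compact_finite_cover (T : topologicalType) (U : set T) :
  compact U -> cover_compact U.
Proof.
have [->|/set0P[x _]] := eqVneq U set0.
  by move=> _ I D f _ _; exists fset0 => // ?; rewrite inE.
pose pT : ptopologicalType := HB.pack (T : Type) T (isPointed.Build T x).
by rewrite -[compact U]/(@compact pT U) compact_cover.
Qed.

Section ScottCompactOpen.
Context (d : Order.disp_t) (L : porderType d).

Lemma lawson_open_scott (U : set L) :
  open (U : set (scott L)) -> open (U : set (lawson L)).
Proof.
move=> oU; exists [set U]; last by rewrite bigcup_set1.
move=> _ ->; exists [fset (U : set L)]%fset.
  by move=> V /fset1P ->; rewrite inE; left.
by rewrite set_fset1 bigcap_set1.
Qed.

(** The complement of the filter is a subbasic lower open set, and lower open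
sets are in turn subbasic for the Lawson topology. *)
Lemma lawson_closed_filter x : closed (principal_filter x : set (lawson L)).
Proof.
rewrite -openC; set U := ~` _.
exists [set U]; last by rewrite bigcup_set1.
move=> _ ->; exists [fset (U : set L)]%fset;
  last by rewrite set_fset1 bigcap_set1.
move=> V /fset1P ->; rewrite inE; right.
exists [set U]; last by rewrite bigcup_set1.
move=> _ ->; exists [fset (U : set L)]%fset;
  last by rewrite set_fset1 bigcap_set1.
by move=> W /fset1P ->; rewrite inE; exists x.
Qed.

Lemma lawson_closed_upper_closure s : closed (upper_closure s : set (lawson L)).
Proof.
have -> : upper_closure s = \bigcup_(k in [set` s]) principal_filter k.
  by rewrite predeqE => x; split=> -[k ks kx]; exists k.
apply: closed_bigcup; first exact: finite_seq.
by move=> k _; exact: lawson_closed_filter.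
Qed.

Lemma lawson_compact_scott (U : set L) :
  compact (U : set (lawson L)) -> compact (U : set (scott L)).
Proof.
move=> cU F FF FU; have [p [Up clp]] := cU F FF FU.
exists p; split=> // V W FV; rewrite nbhsE => -[O [oO Op] OW].
apply: clp => //; rewrite nbhsE; exists O => //.
by split=> //; exact: lawson_open_scott.
Qed.

Lemma scott_open_filter k : compact_elements k ->
  open (principal_filter k : set (scott L)).
Proof.
move=> kc; split=> [x y|D s dD Ds ks]; first exact: le_trans.
by have [x Dx kx] := kc D s dD Ds ks; exists x.
Qed.

(** A Scott open set that contains [k] contains the whole filter, so [k] is a
cluster point of every proper filter of sets containing [↑k]. *)
Lemma scott_compact_filter k : compact (principal_filter k : set (scott L)).
Proof.
move=> F FF Fk; exists k; split=> [|V W FV]; first exact: lexx.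
rewrite nbhsE => -[O [oO Ok] OW].
have [x [Vx kx]] : V `&` principal_filter k !=set0.
  by apply: (@filter_ex _ F); exact: filterI.
by exists x; split=> //; apply: OW; exact: oO.1 Ok kx.
Qed.

Lemma CO_filter k : compact_elements k -> CO L (principal_filter k).
Proof.
by split; [exact: scott_compact_filter|exact: scott_open_filter].
Qed.

(** By algebraicity the filters of the compact elements of [U] cover [U]; a
finite subcover gives the generators. *)
Lemma CO_upper_closure U : algebraic_domain L -> CO L U ->
  exists2 s : seq L, (forall k, k \in s -> compact_elements k) &
    U = upper_closure s.
Proof.
move=> [_ alg] [/compact_finite_cover cU oU]; have := cU.
move=> /(_ L (U `&` @compact_elements _ L) (@principal_filter _ L)).
case.
- by move=> k [_ kc]; exact: scott_open_filter.
- move=> x Ux; have [dx sx] := alg x.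
  have [k [[kx kc] Uk]] := oU.2 _ _ dx sx Ux.
  by exists k.
- move=> F FU UF; exists F => [k /FU|].
    by rewrite inE => -[].
  rewrite predeqE => x; split=> [/UF[k kF kx]|[k kF kx]]; first by exists k.
  have := FU k kF; rewrite inE => -[Uk _].
  exact: oU.1 Uk kx.
Qed.

(** The step that uses Lawson compactness: compact-open sets are Lawson closed,
and closed sets are stable under intersection. *)
Lemma CO_setI : algebraic_domain L -> lawson_compact L -> setI_closed (CO L).
Proof.
move=> alg lc U V CU CV.
have clo W : CO L W -> closed (W : set (lawson L)).
  by move=> /(CO_upper_closure alg)[s _ ->]; exact: lawson_closed_upper_closure.
split; last exact: openI CU.2 CV.2.
apply: lawson_compact_scott; apply: subclosed_compact lc _ => //.
by apply: closedI; exact: clo.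
Qed.

End ScottCompactOpen.

Theorem theorem3p8 (d : Order.disp_t) (L : porderType d) :
  algebraic_L_domain L -> lawson_compact L -> FDD_lattice {U : set (scott L) | U \in CO L}.
Proof.
move=> [alg cpl] lc.
have CO0 : CO L set0 by split; [exact: compact0|exact: open0].
have COT : CO L setT by split; [exact: lawson_compact_scott|exact: openT].
have COU : setU_closed (CO L).
  by move=> U V [cU oU] [cV oV]; split; [exact: compactU|exact: openU].
have [A AE [v [v_inj vC v0 vU vI]]] :=
  ring_of_sets_tbDistrLattice CO0 COT COU (CO_setI alg lc).
have Cv x : CO L (v x) by rewrite -vC; exists x.
exists A => //; apply: (FDD_axioms_upper_sets v_inj v0 vU vI).
- by move=> x; exact: (Cv x).2.1.
- move=> x; have [s sc vE] := CO_upper_closure alg (Cv x).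
  by exists s => // k /sc kc; rewrite vC; exact: CO_filter.
- by move=> a b t; exact: minimal_upper_bounds_disjoint.
Qed.
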